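(* Let $(X,\mathcal{T},(I_i)_{i\in\mathbb{N}})$ be a computable topological space and let $S$ be a semicomputable set in this space which is, as a subspace of $(X,\mathcal{T})$, an $n$-manifold for some $n\in\mathbb{N}\setminus\{0\}$. Then $S$ is a computable set in $(X,\mathcal{T},(I_i))$.
   Context: Fix a function $j\mapsto[j]$ from $\mathbb{N}$ onto the set of all nonempty finite subsets of $\mathbb{N}$ which is computably finite valued: the set $\{(j,i)\in\mathbb{N}^2 : i\in[j]\}$ is computable and there is a computable $\varphi:\mathbb{N}\to\mathbb{N}$ with $[j]\subseteq\{0,\dots,\varphi(j)\}$ for all $j$. A computable topological space is a triple $(X,\mathcal{T},(I_i)_{i\in\mathbb{N}})$ where $(X,\mathcal{T})$ is a topological space, $\{I_i : i\in\mathbb{N}\}\subseteq\mathcal{T}$ is a basis for $\mathcal{T}$, and there exist c.e. sets $\mathcal{C},\mathcal{D}\subseteq\mathbb{N}^2$ such that: (1) if $(i,j)\in\mathcal{D}$ then $I_i\cap I_j=\emptyset$; (2) if $(i,j)\in\mathcal{C}$ then $I_i\subseteq I_j$; (3) if $x\neq y$ in $X$, there exist $i,j$ with $x\in I_i$, $y\in I_j$, $(i,j)\in\mathcal{D}$; (4) if $x\in I_i\cap I_j$, there exists $k$ with $x\in I_k$, $(k,i),(k,j)\in\mathcal{C}$. For $j\in\mathbb{N}$ let $J_j=\bigcup_{i\in[j]}I_i$. A compact set $S$ is semicomputable if $\{j: S\subseteq J_j\}$ is c.e.; a closed set $S$ is c.e. if $\{i: I_i\cap S\neq\emptyset\}$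 is c.e.; a compact set is computable if it is both c.e. and semicomputable. A topological space is an $n$-manifold if each of its points has a neighborhood homeomorphic to $\mathbb{R}^n$. *)

(* Defs.v *)
From HB Require Import structures.
From mathcomp Require Import all_boot all_order all_algebra.
From mathcomp Require Import all_classical all_reals all_analysis.
Set Implicit Arguments. Unset Strict Implicit. Unset Printing Implicit Defensive.
Import numFieldNormedType.Exports.
Local Open Scope classical_set_scope.

(* Kleene's mu-recursive functions: [recf k] is the syntax of the partial
   recursive functions from nat^k to nat. *)
Inductive recf : nat -> Type :=
| RZero k : recf k
| RSucc : recf 1
| RProj k of 'I_k : recf k
| RComp m k of recf m & ('I_m -> recf k) : recf k
| RPrim k of recf k & recf k.+2 : recf k.+1
| RMu k of recf k.+1 : recf k.

(* [recf_graph c v y]: the partial function denoted by c is defined at v, with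
   value y. The recursion variable of RPrim and the searched variable of RMu
   both come first: if h = RPrim f g then h(0, v) = f(v) and
   h(n+1, v) = g(n, h(n, v), v). RMu f is defined at v only if f(z, v) is
   defined for all z up to the value. *)
Fixpoint recf_graph k (c : recf k) : k.-tuple nat -> nat -> Prop :=
  match c in recf k return k.-tuple nat -> nat -> Prop with
  | RZero _ => fun _ y => y = 0
  | RSucc => fun v y => y = (thead v).+1
  | RProj _ i => fun v y => y = tnth v i
  | RComp m _ f g => fun v y => exists w : m.-tuple nat,
      (forall i, recf_graph (g i) v (tnth w i)) /\ recf_graph f w y
  | RPrim k f g => fun v y =>
      let u : k.-tuple nat := behead_tuple v in
      (fix iter_graph n y := match n with
       | 0 => recf_graph f u y
       | n'.+1 => exists z, iter_graph n' z /\
                            recf_graph g (cons_tuple n' (cons_tuple z u)) y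
       end) (thead v) y
  | RMu _ f => fun v y => recf_graph f (cons_tuple y v) 0 /\
      forall z, z < y -> exists t, recf_graph f (cons_tuple z v) t.+1
  end.

Definition computable_fun k (F : k.-tuple nat -> nat) :=
  exists c : recf k, forall v, recf_graph c v (F v).

Definition computable_fun1 (f : nat -> nat) :=
  computable_fun (fun v : 1.-tuple nat => f (thead v)).

Definition computable_set2 (A : set (nat * nat)) :=
  computable_fun (fun v : 2.-tuple nat =>
    nat_of_bool `[< A (tnth v ord0, tnth v ord_max) >]).

Definition ce_set1 (A : set nat) :=
  A = set0 \/ exists2 f, computable_fun1 f & A = range f.

Definition ce_set2 (A : set (nat * nat)) :=
  A = set0 \/ exists f g, [/\ computable_fun1 f, computable_fun1 g &
    A = range (fun n => (f n, g n))].

(* [br j] is the finite set written [j] in the literature. *)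
Definition finite_subsets_enum (br : nat -> set nat) :=
  [/\ range br = [set A | finite_set A /\ A !=set0],
      computable_set2 [set p | br p.1 p.2] &
      exists2 phi, computable_fun1 phi &
        forall j, br j `<=` [set i | i <= phi j]].

Definition computable_topological_space (X : topologicalType)
    (I : nat -> set X) :=
  basis (range I) /\
  exists C D : set (nat * nat), ce_set2 C /\ ce_set2 D /\
    [/\ forall i j, D (i, j) -> I i `&` I j = set0,
        forall i j, C (i, j) -> I i `<=` I j,
        forall x y, x <> y -> exists i j, [/\ I i x, I j y & D (i, j)] &
        forall i j x, I i x -> I j x ->
          exists k, [/\ I k x, C (k, i) & C (k, j)]].

Section computable_subsets.
Context {X : topologicalType} (br : nat -> set nat) (I : nat -> set X).

Definition Jset (j : nat) : set X := \bigcup_(i in br j) I i.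

Definition semicomputable (S : set X) :=
  compact S /\ ce_set1 [set j | S `<=` Jset j].

Definition ce_closed (S : set X) :=
  closed S /\ ce_set1 [set i | I i `&` S !=set0].

Definition computable_compact (S : set X) :=
  [/\ compact S, ce_closed S & semicomputable S].

End computable_subsets.

Definition homeomorphic (A B : topologicalType) :=
  exists (f : A -> B) (g : B -> A),
    [/\ cancel f g, cancel g f, continuous f & continuous g].

Definition manifold (R : realType) (n : nat) (M : topologicalType) :=
  forall x : M, exists2 N : set M,
    nbhs x N & homeomorphic (set_type N) 'rV[R]_n.

(* Main.v *)
(* That I_i meets S is certified by a finite cover of S. If I_i meets S at h(c)
   for a chart h, a small cube around c is mapped into I_i, and the rest of the
   chart is covered by formally disjoint neighbourhoods U_k, V_k of the sides
   v_k <= c_k - e and v_k >= c_k + e. Conversely, such a cover forces I_i to meet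
   S by Lebesgue's covering theorem: [-1,1]^n is not covered by open sets U_k,
   V_k (k < n) with U_k disjoint from V_k and from the face v_k = 1, and V_k
   disjoint from the face v_k = -1. Finite covers of S, formal inclusion and
   formal disjointness of basic sets are c.e., so near each point of S the i with
   I_i meeting S can be enumerated; finitely many charts suffice.

   The covering theorem is reduced to a fine grid, where it is a mod 2 Stokes
   formula: the cup product of the coboundaries of n bits b_k, with b_k = 0 on
   the face p_k = 0 and b_k = 1 on the face p_k = N, sums to 1 over the grid, so
   on some unit cube no b_k is constant. *)
Require Import Defs.
From mathcomp Require Import all_boot all_order all_algebra.
From mathcomp Require Import all_classical all_reals all_analysis.
From mathcomp Require Import zify ring lra.
Set Implicit Arguments. Unset Strict Implicit. Unset Printing Implicit Defensive.
Import Order.TTheory GRing.Theory Num.Theory.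
Import numFieldNormedType.Exports.
Local Open Scope classical_set_scope.

(** * Computable functions and c.e. predicates *)

(* Functions of k variables read their arguments from an environment v of size
   k; nothing is claimed on environments of another size. *)
Definition recfun k (F : seq nat -> nat) :=
  exists c : recf k, forall v : k.-tuple nat, recf_graph c v (F v).

Definition recpred k (P : seq nat -> bool) := recfun k (fun v => P v).

Fixpoint recfuns k (s : seq (seq nat -> nat)) : Prop :=
  if s is G :: s' then recfun k G /\ recfuns k s' else True.

Lemma recfun_ext k F G : recfun k F -> (forall v, size v = k -> F v = G v) ->
  recfun k G.
Proof. by move=> [c hc] FG; exists c => v; rewrite -FG ?size_tuple. Qed.

Lemma recfuns_nth k s i : recfuns k s -> i < size s ->
  recfun k (nth (fun=> 0) s i).
Proof. by elim: s i => //= G s IH [|i] [hG hs]//; apply: IH. Qed.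

Lemma recfun_comp k m F s : recfun m F -> size s = m -> recfuns k s ->
  recfun k (fun v => F [seq G v | G <- s]).
Proof.
move=> hF sm; move: hF; rewrite -{m}sm => -[c hc] hs.
have /choice[g hg] : forall i : 'I_(size s), exists d : recf k,
    forall v : k.-tuple nat, recf_graph d v (nth (fun=> 0) s i v).
  by move=> i; apply: recfuns_nth.
exists (RComp c g) => v /=.
exists (map_tuple (fun G : seq nat -> nat => G v) (in_tuple s)).
split; last exact: (hc (map_tuple _ _)).
by move=> i; rewrite tnth_map (tnth_nth (fun=> 0)); exact: hg.
Qed.

Lemma recfun_var k i : i < k -> recfun k (fun v => nth 0 v i).
Proof. by move=> ik; exists (RProj (Ordinal ik)) => v /=; rewrite (tnth_nth 0). Qed.

Lemma recfun_succ k F : recfun k F -> recfun k (fun v => (F v).+1).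
Proof.
have S1 : recfun 1 (fun v => (nth 0 v 0).+1).
  by exists RSucc => v /=; rewrite /thead (tnth_nth 0).
by move=> hF; apply: (@recfun_comp k 1 _ [:: F] S1).
Qed.

Lemma recfun_const k c : recfun k (fun=> c).
Proof. by elim: c => [|c /recfun_succ//]; exists (RZero k). Qed.

Lemma recfun_prim k f g : recfun k f -> recfun k.+2 g ->
  recfun k.+1 (fun v => nat_rect (fun=> nat) (f (behead v))
    (fun n z => g (n :: z :: behead v)) (head 0 v)).
Proof.
move=> [c hc] [d hd]; exists (RPrim c d) => v /=.
have -> : thead v = head 0 v by rewrite /thead (tnth_nth 0) nth0.
elim: (head 0 v) => [|n IH] /=; first exact: (hc (behead_tuple v)).
eexists; split; first exact: IH.
exact: (hd (cons_tuple n (cons_tuple _ (behead_tuple v)))).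
Qed.

(** The search of [RMu] ends on every input, since [M] is given in advance and assumed to return the
    least zero. *)
Lemma recfun_mu k f M : recfun k.+1 f ->
  (forall v, size v = k -> f (M v :: v) = 0 /\
    forall z, z < M v -> f (z :: v) != 0) -> recfun k M.
Proof.
move=> [c hc] hM; exists (RMu c) => v /=.
have [fM0 fz] := hM v (size_tuple v).
split; first by rewrite -fM0; exact: (hc (cons_tuple _ v)).
move=> z /fz; rewrite -lt0n => h; exists (f (z :: v)).-1; rewrite prednK//.
Qed.

(** Projections onto consecutive arguments: composing with them drops the first [d] entries of the
    environment, so that a function can be reused under extra leading arguments. *)
Definition vars d k : seq (seq nat -> nat) :=
  [seq (fun v : seq nat => nth 0 v i) | i <- iota d k].

Lemma size_vars d k : size (vars d k) = k.
Proof. by rewrite size_map size_iota. Qed.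

Lemma vars_map d k v : size v = d + k -> [seq G v | G <- vars d k] = drop d v.
Proof.
move=> vk; rewrite -map_comp; apply: (@eq_from_nth _ 0).
  by rewrite size_map size_iota size_drop vk addKn.
move=> i; rewrite size_map size_iota => ik.
by rewrite (nth_map 0) ?size_iota//= nth_iota// nth_drop.
Qed.

Lemma recfuns_vars d k m : d + k <= m -> recfuns m (vars d k).
Proof.
move=> dkm; have : {in iota d k, forall i, i < m}.
  by move=> i; rewrite mem_iota => /andP[_ /leq_trans]; exact.
rewrite /vars; elim: (iota d k) => //= i r IH h; split.
  by apply: recfun_var; apply: h; rewrite mem_head.
by apply: IH => j jr; apply: h; rewrite inE jr orbT.
Qed.

Lemma recfun_let k F B : recfun k.+1 F -> recfun k B ->
  recfun k (fun v => F (B v :: v)).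
Proof.
move=> hF hB; apply: recfun_ext (_ : recfun k (fun v => F [seq G v | G <- B :: vars 0 k])) _.
  apply: recfun_comp hF _ _; first by rewrite /= size_vars.
  by split => //; exact: recfuns_vars.
by move=> v vk /=; rewrite vars_map ?drop0.
Qed.

Lemma recfun_op1 k (f : nat -> nat) A : recfun 1 (fun v => f (nth 0 v 0)) ->
  recfun k A -> recfun k (fun v => f (A v)).
Proof. by move=> hf hA; apply: (@recfun_comp k 1 _ [:: A] hf). Qed.

Lemma recfun_op2 k (f : nat -> nat -> nat) A B :
  recfun 2 (fun v => f (nth 0 v 0) (nth 0 v 1)) ->
  recfun k A -> recfun k B -> recfun k (fun v => f (A v) (B v)).
Proof. by move=> hf hA hB; apply: (@recfun_comp k 2 _ [:: A; B] hf). Qed.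

Lemma recfun_rec2 (f : nat -> nat -> nat) A g : recfun 1 A -> recfun 3 g ->
  (forall y, f 0 y = A [:: y]) -> (forall n y, f n.+1 y = g [:: n; f n y; y]) ->
  recfun 2 (fun v => f (nth 0 v 0) (nth 0 v 1)).
Proof.
move=> hA hg f0 fS; apply: recfun_ext (recfun_prim hA hg) _.
by case=> [|x [|y []]]//= _; elim: x => [|x IH]; rewrite ?f0//= IH fS.
Qed.

Lemma recfun_add k A B : recfun k A -> recfun k B ->
  recfun k (fun v => A v + B v).
Proof.
apply: recfun_op2; apply: (@recfun_rec2 _ (fun v => nth 0 v 0)
  (fun v => (nth 0 v 1).+1)) => //; first exact: recfun_var.
by apply: recfun_succ; exact: recfun_var.
Qed.

Lemma recfun_mul k A B : recfun k A -> recfun k B ->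
  recfun k (fun v => A v * B v).
Proof.
apply: recfun_op2; apply: (@recfun_rec2 _ (fun=> 0)
  (fun v => nth 0 v 2 + nth 0 v 1)) => //; first exact: recfun_const.
by apply: recfun_add; exact: recfun_var.
Qed.

Lemma recfun_pred k A : recfun k A -> recfun k (fun v => (A v).-1).
Proof.
move=> hA; apply: (@recfun_op2 k (fun x _ => x.-1) A A) => //.
apply: (@recfun_rec2 (fun x _ => x.-1) (fun=> 0) (fun v => nth 0 v 0)) => //.
  exact: recfun_const.
exact: recfun_var.
Qed.

Lemma recfun_sub k A B : recfun k A -> recfun k B ->
  recfun k (fun v => A v - B v).
Proof.
(* Arguments are swapped because the recursion runs over the first one: [y - x] is the [x]-fold
   predecessor of [y]. *)
move=> hA hB; apply: (@recfun_op2 k (fun x y => y - x) B A) => //.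
apply: (@recfun_rec2 (fun x y => y - x) (fun v => nth 0 v 0)
  (fun v => (nth 0 v 1).-1)) => //.
- exact: recfun_var.
- by apply: recfun_pred; exact: recfun_var.
- by move=> y; rewrite subn0.
- by move=> n y; rewrite subnS.
Qed.

Lemma recpred_neg k P : recpred k P -> recpred k (fun v => ~~ P v).
Proof.
move=> hP; apply: recfun_ext (recfun_sub (recfun_const k 1) hP) _.
by move=> v _; case: (P v).
Qed.

Lemma recpred_and k P Q : recpred k P -> recpred k Q ->
  recpred k (fun v => P v && Q v).
Proof.
move=> hP hQ; apply: recfun_ext (recfun_mul hP hQ) _.
by move=> v _; rewrite mulnb.
Qed.

Lemma recpred_or k P Q : recpred k P -> recpred k Q ->
  recpred k (fun v => P v || Q v).
Proof.
move=> hP hQ.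
apply: recfun_ext (recpred_neg (recpred_and (recpred_neg hP) (recpred_neg hQ))) _.
by move=> v _; case: (P v); case: (Q v).
Qed.

Lemma recpred_leq k A B : recfun k A -> recfun k B ->
  recpred k (fun v => A v <= B v).
Proof.
move=> hA hB; apply: recfun_ext (recfun_sub (recfun_const k 1) (recfun_sub hA hB)) _.
by move=> v _; rewrite /leq; case: (A v - B v).
Qed.

Lemma recpred_eq k A B : recfun k A -> recfun k B ->
  recpred k (fun v => A v == B v).
Proof.
move=> hA hB.
apply: recfun_ext (recpred_and (recpred_leq hA hB) (recpred_leq hB hA)) _.
by move=> v _; rewrite eqn_leq.
Qed.

Lemma recpred_mem2 k A B (r : seq (nat * nat)) : recfun k A -> recfun k B ->
  recpred k (fun v => (A v, B v) \in r).
Proof.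
move=> hA hB; elim: r => [|[a b] r IH]; first exact: recfun_const.
have h := recpred_or (recpred_and (recpred_eq hA (recfun_const k a))
  (recpred_eq hB (recfun_const k b))) IH.
by apply: recfun_ext h _ => v _; rewrite inE xpair_eqE.
Qed.

Lemma recpred_ball k P B : recpred k.+1 P -> recfun k B ->
  recpred k (fun v => all (fun x => P (x :: v)) (iota 0 (B v))).
Proof.
move=> hP hB.
(* Bounded quantification is a product of truth values: entry 0 is the recursion variable, entry 1
   the product so far. *)
have g : recfun k.+2 (fun v => nth 0 v 1 * P (nth 0 v 0 :: drop 2 v)).
  apply: recfun_mul; first exact: recfun_var.
  apply: recfun_ext (_ : recfun _ (fun v => (P [seq G v | G <-
      (fun v => nth 0 v 0) :: vars 2 k] : nat))) _.
    apply: (recfun_comp hP); first by rewrite /= size_vars.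
    by split; [exact: recfun_var|exact: recfuns_vars].
  by move=> v vk /=; rewrite vars_map.
have := recfun_prim (recfun_const k 1) g => h.
apply: recfun_ext (recfun_let h hB) _ => v _ /=.
elim: (B v) => // n IH; rewrite -[n.+1 in RHS]addn1 iotaD all_cat /= andbT.
by rewrite IH drop0 mulnb.
Qed.

(** * Coding of pairs and finite sequences *)

Lemma isqrt_ex t : exists s, t < s.+1 * s.+1.
Proof. by exists t; rewrite mulSn; lia. Qed.

Definition isqrt t := ex_minn (isqrt_ex t).

(* A surjection t |-> (unpl t, unpr t) onto pairs: (a, b) is the image of
   (a + b) ^ 2 + a. *)
Definition unpl t := t - isqrt t * isqrt t.
Definition unpr t := isqrt t - unpl t.

(** As [a <= a + b], the number [(a + b) ^ 2 + a] lies below the next square, so its integer root is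
    [a + b] and both entries can be read off. *)
Lemma unp_surj a b : exists t, unpl t = a /\ unpr t = b.
Proof.
exists ((a + b) * (a + b) + a); rewrite /unpr /unpl /isqrt.
case: ex_minnP => s h1 /(_ (a + b)) h2.
suff -> : s = a + b by lia.
have : s <= a + b by apply: h2; lia.
by nia.
Qed.

Lemma recfun_isqrt : recfun 1 (fun v => isqrt (nth 0 v 0)).
Proof.
(* Minimization looks for a zero, so the defining test of the root enters negated. *)
apply: (@recfun_mu 1 (fun v =>
  ~~ (nth 0 v 1 < (nth 0 v 0).+1 * (nth 0 v 0).+1))); last first.
  move=> v _ /=; rewrite /isqrt; case: ex_minnP => s -> h2; split => // z.
  by rewrite ltnNge => zs; case: ltnP zs => [/h2->|].
have v0 : recfun 2 (fun v => (nth 0 v 0).+1) by apply/recfun_succ/recfun_var.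
apply: (@recpred_neg 2 (fun v => nth 0 v 1 < (nth 0 v 0).+1 * (nth 0 v 0).+1)).
apply: recpred_leq; last exact: recfun_mul.
exact/recfun_succ/recfun_var.
Qed.

Lemma recfun_unpl k A : recfun k A -> recfun k (fun v => unpl (A v)).
Proof.
move=> hA; have h := recfun_op1 recfun_isqrt hA.
by apply: recfun_sub => //; exact: recfun_mul.
Qed.

Lemma recfun_unpr k A : recfun k A -> recfun k (fun v => unpr (A v)).
Proof.
move=> hA; have h := recfun_op1 recfun_isqrt hA.
by apply: recfun_sub => //; exact: recfun_unpl.
Qed.

(** Every number codes an infinite sequence by iterated unpairing; no length is stored, and any
    finite sequence is a prefix of a coded one. *)
Definition lnth i t := unpl (iter i unpr t).

Lemma lnth_surj (f : nat -> nat) m : exists t, forall i, i < m -> lnth i t = f i.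
Proof.
elim: m f => [|m IH] f; first by exists 0.
have [t ht] := IH (f \o S); have [u [u1 u2]] := unp_surj (f 0) t.
by exists u => -[_ //|i im]; rewrite /lnth iterSr u2; exact: ht.
Qed.

Lemma recfun_lnth k A B : recfun k A -> recfun k B ->
  recfun k (fun v => lnth (A v) (B v)).
Proof.
apply: recfun_op2; apply: recfun_unpl.
apply: (@recfun_rec2 (fun x y => iter x unpr y) (fun v => nth 0 v 0)
  (fun v => unpr (nth 0 v 1))) => //; first exact: recfun_var.
by apply: recfun_unpr; exact: recfun_var.
Qed.

(** * C.e. predicates as projections of decidable ones *)

Definition sigma1 k (A : seq nat -> Prop) := exists2 P, recpred k.+1 P &
  forall v, size v = k -> (A v <-> exists w, P (w :: v)).

Lemma sigma1_ext k A B : sigma1 k A -> (forall v, size v = k -> (A v <-> B v)) ->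
  sigma1 k B.
Proof. by move=> [P hP AP] AB; exists P => // v vk; rewrite -AB// AP. Qed.

Lemma recfun_subst k m F (s : seq (seq nat -> nat)) G : recfun m F ->
  size s = m -> recfuns k s -> (forall v, size v = k -> G v = F [seq H v | H <- s]) ->
  recfun k G.
Proof.
by move=> hF sm hs FG; apply: recfun_ext (recfun_comp hF sm hs) _ => v /FG.
Qed.

Lemma sigma1_subst k m A s : sigma1 m A -> size s = m -> recfuns k s ->
  sigma1 k (fun v => A [seq G v | G <- s]).
Proof.
move=> [P hP AP] sm hs.
exists (fun v => P (nth 0 v 0 :: [seq G (behead v) | G <- s])).
  apply: (@recfun_subst k.+1 m.+1 _
    ((fun v => nth 0 v 0) :: [seq (fun v => G (behead v)) | G <- s]) _ hP) => /=.
  - by rewrite size_map sm.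
  - split; first exact: recfun_var.
    elim: (s) hs => //= G s' IH [hG hs]; split; last exact: IH.
    apply: (@recfun_subst _ k _ (vars 1 k) _ hG); first by rewrite size_vars.
      exact: recfuns_vars.
    by move=> v vk; rewrite vars_map// drop1.
  - by move=> v _; rewrite -map_comp.
by move=> v vk; apply: AP; rewrite size_map.
Qed.

Lemma sigma1_rec k P : recpred k P -> sigma1 k P.
Proof.
move=> hP; exists (fun v => P (behead v)); last first.
  by move=> v _ /=; split=> [|[]//]; exists 0.
apply: (@recfun_subst _ k _ (vars 1 k) _ hP); first by rewrite size_vars.
  exact: recfuns_vars.
by move=> v vk; rewrite vars_map// drop1.
Qed.

(** The quantified variable and the old witness are packed into one new witness by pairing. *)
Lemma sigma1_ex k A : sigma1 k.+1 A -> sigma1 k (fun v => exists x, A (x :: v)).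
Proof.
move=> [P hP AP].
exists (fun v => P (unpr (nth 0 v 0) :: unpl (nth 0 v 0) :: behead v)).
  apply: (@recfun_subst _ k.+2 _ ((fun v => unpr (nth 0 v 0)) ::
    (fun v => unpl (nth 0 v 0)) :: vars 1 k) _ hP); first by rewrite /= size_vars.
    split; first exact/recfun_unpr/recfun_var.
    by split; [exact/recfun_unpl/recfun_var|exact: recfuns_vars].
  by move=> v vk /=; rewrite vars_map// drop1.
move=> v vk; split=> [[x]|[t] /= h].
  rewrite AP /= ?vk// => -[w h]; have [t [t1 t2]] := unp_surj x w.
  by exists t; rewrite /= t1 t2.
by exists (unpl t); rewrite AP/= ?vk//; exists (unpr t).
Qed.

Lemma sigma1_andrec k P A : recpred k P -> sigma1 k A ->
  sigma1 k (fun v => P v /\ A v).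
Proof.
move=> hP [Q hQ AQ]; exists (fun v => P (behead v) && Q v); last first.
  move=> v vk; rewrite AQ//; split=> [[? [w ?]]|[w /andP[? ?]]].
    by exists w; apply/andP.
  by split => //; exists w.
apply: recpred_and => //.
apply: (@recfun_subst _ k _ (vars 1 k) _ hP); first by rewrite size_vars.
  exact: recfuns_vars.
by move=> v vk; rewrite vars_map// drop1.
Qed.

Lemma sigma1_or k A B : sigma1 k A -> sigma1 k B -> sigma1 k (fun v => A v \/ B v).
Proof.
move=> [P hP AP] [Q hQ BQ]; exists (fun v => P v || Q v).
  exact: recpred_or.
move=> v vk; rewrite AP// BQ//; split=> [[] [w h]|[w /orP[h|h]]].
- by exists w; rewrite h.
- by exists w; rewrite h orbT.
- by left; exists w.
- by right; exists w.
Qed.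

Lemma sigma1_and k A B : sigma1 k A -> sigma1 k B -> sigma1 k (fun v => A v /\ B v).
Proof.
move=> [P hP AP] [Q hQ BQ].
(* The witness for [A] becomes an outer quantifier, which leaves a decidable conjunct. *)
apply: sigma1_ext (_ : sigma1 k (fun v => exists x, P (x :: v) /\ B v)) _.
  apply: (@sigma1_ex k (fun v => P v /\ B (behead v))); apply: sigma1_andrec => //.
  apply: sigma1_ext (_ : sigma1 _ (fun v => B [seq G v | G <- vars 1 k])) _.
    apply: (sigma1_subst (m := k)); last exact: recfuns_vars.
      by exists Q.
    by rewrite size_vars.
  by move=> v vk; rewrite vars_map// drop1.
by move=> v vk; rewrite AP//; split=> [[x [? ?]]|[[x ?] ?]]; [split => //; exists x|exists x].
Qed.

(** The witnesses for the finitely many [x] below the bound are coded by a single number, the one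
    for [x] being its [x]-th entry. *)
Lemma sigma1_ball k A B : sigma1 k.+1 A -> recfun k B ->
  sigma1 k (fun v => forall x, x < B v -> A (x :: v)).
Proof.
move=> [P hP AP] hB.
exists (fun v => all (fun x => P (lnth x (nth 0 v 0) :: x :: behead v))
  (iota 0 (B (behead v)))).
  apply: (@recpred_ball k.+1 (fun v => P (lnth (nth 0 v 0) (nth 0 v 1) ::
    nth 0 v 0 :: behead (behead v))) (fun v => B (behead v))); last first.
    apply: (@recfun_subst _ k _ (vars 1 k) _ hB); first by rewrite size_vars.
      exact: recfuns_vars.
    by move=> v vk; rewrite vars_map// drop1.
  apply: (@recfun_subst _ k.+2 _ ((fun v => lnth (nth 0 v 0) (nth 0 v 1)) ::
    (fun v => nth 0 v 0) :: vars 2 k) _ hP); first by rewrite /= size_vars.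
    split; first by apply: recfun_lnth; exact: recfun_var.
    by split; [exact: recfun_var|exact: recfuns_vars].
  by move=> v vk /=; rewrite vars_map// -!drop1 drop_drop.
move=> v vk; split=> [h|[t /= /allP h] x xB]; last first.
  rewrite AP/= ?vk//; exists (lnth x t); apply: h.
  by rewrite mem_iota.
have /choice[f hf] : forall x, exists w, x < B v -> P (w :: x :: v).
  move=> x; have [xB|_] := ltnP x (B v); last by exists 0.
  by have := h _ xB; rewrite AP/= ?vk// => -[w]; exists w.
have [t ht] := lnth_surj f (B v); exists t => /=.
by apply/allP => x; rewrite mem_iota /= => xB; rewrite ht// hf.
Qed.

Lemma sigma1_seq k (J : eqType) (r : seq J) (A : J -> seq nat -> Prop) :
  (forall x, sigma1 k (A x)) -> sigma1 k (fun v => exists2 x, x \in r & A x v).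
Proof.
move=> hA; elim: r => [|y r IH].
  apply: sigma1_ext (_ : sigma1 k (fun=> false)) _; last by move=> v _; split=> // -[].
  by apply: sigma1_rec; exact: recfun_const.
apply: sigma1_ext (sigma1_or (hA y) IH) _ => v _; split.
  by case=> [h|[x xr h]]; [exists y; rewrite ?mem_head|exists x; rewrite ?inE ?xr ?orbT].
by case=> x; rewrite inE => /predU1P[->|xr] h; [left|right; exists x].
Qed.

Lemma recfun_computable1 k f A : computable_fun1 f -> recfun k A ->
  recfun k (fun v => f (A v)).
Proof.
move=> [c hc]; apply: recfun_op1; exists c => v.
by have := hc v; rewrite /thead (tnth_nth 0).
Qed.

Lemma sigma1_ce1 k T A : ce_set1 T -> recfun k A -> sigma1 k (fun v => T (A v)).
Proof.
move=> hT hA; apply: (@sigma1_subst k 1 (fun v => T (nth 0 v 0)) [:: A]) => //.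
case: hT => [->|[f cf ->]].
  apply: sigma1_ext (_ : sigma1 1 (fun=> false)) _ => //.
  by apply: sigma1_rec; exact: recfun_const.
apply: sigma1_ext (_ : sigma1 1 (fun v => exists x, f x == nth 0 v 0)) _.
  apply: (@sigma1_ex 1 (fun v => f (nth 0 v 0) == nth 0 v 1)); apply: sigma1_rec.
  apply: recpred_eq; last exact: recfun_var.
  by apply: recfun_computable1 => //; exact: recfun_var.
by move=> v _; split=> [[x /eqP <-]|[x _ <-]]; [exists x|exists x; rewrite eqxx].
Qed.

Lemma sigma1_ce2 k C A B : ce_set2 C -> recfun k A -> recfun k B ->
  sigma1 k (fun v => C (A v, B v)).
Proof.
move=> hC hA hB.
apply: (@sigma1_subst k 2 (fun v => C (nth 0 v 0, nth 0 v 1)) [:: A; B]) => //.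
case: hC => [->|[f [g [cf cg ->]]]].
  apply: sigma1_ext (_ : sigma1 2 (fun=> false)) _ => //.
  by apply: sigma1_rec; exact: recfun_const.
apply: sigma1_ext (_ : sigma1 2 (fun v => exists x,
    (f x == nth 0 v 0) && (g x == nth 0 v 1))) _.
  apply: (@sigma1_ex 2 (fun v => (f (nth 0 v 0) == nth 0 v 1) &&
    (g (nth 0 v 0) == nth 0 v 2))); apply: sigma1_rec.
  apply: recpred_and; apply: recpred_eq; try exact: recfun_var.
    by apply: recfun_computable1 => //; exact: recfun_var.
  by apply: recfun_computable1 => //; exact: recfun_var.
move=> v _; split=> [[x /andP[/eqP <- /eqP <-]]|[x _ [<- <-]]]; first by exists x.
by exists x; rewrite !eqxx.
Qed.

Lemma ce_sigma1 (A : set nat) : sigma1 1 (fun v => A (nth 0 v 0)) -> ce_set1 A.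
Proof.
move=> [P hP AP]; have [[a Aa]|A0] := pselect (exists a, A a); last first.
  by left; apply/seteqP; split=> // a Aa; case: A0; exists a.
right; pose Q t := P [:: unpr t; unpl t].
(* Here [t] codes a candidate and a witness; if the test fails, the fixed element [a] is output,
   which keeps the enumeration total. *)
exists (fun t => Q t * unpl t + (1 - Q t) * a).
  have hQ : recfun 1 (fun v => Q (nth 0 v 0)).
    apply: (@recfun_subst _ 2 _ [:: (fun v => unpr (nth 0 v 0));
      (fun v => unpl (nth 0 v 0))] _ hP) => //.
    split; first exact/recfun_unpr/recfun_var.
    by split => //; exact/recfun_unpl/recfun_var.
  have [c hc] : recfun 1 (fun v => Q (nth 0 v 0) * unpl (nth 0 v 0) +
      (1 - Q (nth 0 v 0)) * a).
    apply: recfun_add; first by apply: recfun_mul => //; exact/recfun_unpl/recfun_var.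
    by apply: recfun_mul; [apply: recfun_sub => //|]; exact: recfun_const.
  by exists c => v; have := hc v; rewrite /thead (tnth_nth 0).
apply/seteqP; split=> [x|_ [t _ <-]].
  move/(AP [:: x] erefl) => [w h]; have [t [t1 t2]] := unp_surj x w.
  by exists t => //; rewrite /Q t1 t2 h mul1n subnn mul0n addn0.
case: (boolP (Q t)) => h; last by rewrite mul0n mul1n.
by rewrite mul1n subnn mul0n addn0; apply/(AP [:: unpl t] erefl); exists (unpr t).
Qed.

(** The finitely many enumerations are built into one program, so the indices may be points of a
    space. *)
Lemma ce_set1_bigcup_seq (J : eqType) (r : seq J) (A : J -> set nat) :
  (forall x, ce_set1 (A x)) -> ce_set1 [set i | exists2 x, x \in r & A x i].
Proof.
move=> hA; apply: ce_sigma1; apply: sigma1_seq => x.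
by apply: sigma1_ce1 (hA x) _; exact: recfun_var.
Qed.

(* C refines only two basic sets at a time, so chains in C are needed to refine
   finitely many of them. *)
Definition below (C : set (nat * nat)) (p q : nat) :=
  exists2 s, path (fun x y => `[< C (x, y) >]) p s & last p s = q.

(** [D] need not pass to formally smaller sets; this downward closure does, and it stays c.e. *)
Definition apart (C D : set (nat * nat)) (p q : nat) :=
  exists a b, [/\ below C p a, below C q b & D (a, b)].

Lemma below_refl C p : below C p p.
Proof. by exists [::]. Qed.

Lemma below1 (C : set (nat * nat)) p q : C (p, q) -> below C p q.
Proof. by move=> h; exists [:: q] => //=; rewrite andbT; apply/asboolP. Qed.

Lemma below_trans C q p r : below C p q -> below C q r -> below C p r.
Proof.
move=> [s ps <-] [s' ps' <-]; exists (s ++ s'); first by rewrite cat_path ps.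
by rewrite last_cat.
Qed.

Lemma apart_below C D p q p' q' : apart C D p q -> below C p' p -> below C q' q ->
  apart C D p' q'.
Proof.
by move=> [a [b [pa qb ab]]] p'p q'q; exists a, b; split => //;
  [apply: below_trans pa|apply: below_trans qb].
Qed.

Lemma sigma1_below k C A B : ce_set2 C -> recfun k A -> recfun k B ->
  sigma1 k (fun v => below C (A v) (B v)).
Proof.
move=> hC hA hB.
apply: (@sigma1_subst k 2 (fun v => below C (nth 0 v 0) (nth 0 v 1)) [:: A; B]) => //.
(* A chain with [m] steps is coded by [t], its members being the entries 0 to [m]. *)
apply: sigma1_ext (_ : sigma1 2 (fun v => exists m, exists t,
  ((lnth 0 t == nth 0 v 0) && (lnth m t == nth 0 v 1)) /\
  forall x, x < m -> C (lnth x t, lnth x.+1 t))) _.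
  apply: (@sigma1_ex _ (fun v => exists t,
    ((lnth 0 t == nth 0 v 1) && (lnth (nth 0 v 0) t == nth 0 v 2)) /\
    forall x, x < nth 0 v 0 -> C (lnth x t, lnth x.+1 t))).
  apply: (@sigma1_ex _ (fun v =>
    ((lnth 0 (nth 0 v 0) == nth 0 v 2) &&
      (lnth (nth 0 v 1) (nth 0 v 0) == nth 0 v 3)) /\
    forall x, x < nth 0 v 1 -> C (lnth x (nth 0 v 0), lnth x.+1 (nth 0 v 0)))).
  apply: sigma1_andrec.
    apply: recpred_and; apply: recpred_eq; try exact: recfun_var.
      by apply: recfun_lnth; [exact: recfun_const|exact: recfun_var].
    by apply: recfun_lnth; exact: recfun_var.
  apply: (@sigma1_ball _ (fun v => C (lnth (nth 0 v 0) (nth 0 v 1),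
    lnth (nth 0 v 0).+1 (nth 0 v 1)))); last exact: recfun_var.
  apply: sigma1_ce2 => //; apply: recfun_lnth; try exact: recfun_var.
  exact/recfun_succ/recfun_var.
move=> v _; move: (nth 0 v 0) (nth 0 v 1) => a b; split.
  move=> [m [t [/andP[/eqP t0 /eqP tm] h]]].
  exists [seq lnth x t | x <- iota 1 m].
    apply/(pathP 0) => i; rewrite size_map size_iota => im.
    rewrite (nth_map 0) ?size_iota// nth_iota// add1n; apply/asboolP.
    have -> : nth 0 (a :: [seq lnth x t | x <- iota 1 m]) i = lnth i t.
      case: i im => [|i] im //=; rewrite (nth_map 0) ?size_iota ?(ltnW im)//.
      by rewrite nth_iota// ltnW.
    exact: h.
  rewrite -tm (last_nth 0) size_map size_iota; case: (m) => [//|m'] /=.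
  by rewrite -[_ :: _]/[seq lnth x t | x <- iota 1 m'.+1] (nth_map 0)
    ?size_iota// nth_iota// add1n.
move=> [s ps <-]; have [t ht] := lnth_surj (nth 0 (a :: s)) (size s).+1.
exists (size s), t; split.
  by rewrite !ht// eqxx /= -last_nth eqxx.
move=> x xs; rewrite !ht//; last exact: ltnW.
by have /(pathP 0)/(_ x xs)/asboolP := ps.
Qed.

Lemma sigma1_apart k C D A B : ce_set2 C -> ce_set2 D -> recfun k A -> recfun k B ->
  sigma1 k (fun v => apart C D (A v) (B v)).
Proof.
move=> hC hD hA hB.
apply: (@sigma1_subst k 2 (fun v => apart C D (nth 0 v 0) (nth 0 v 1)) [:: A; B]) => //.
apply: (@sigma1_ex _ (fun v => exists b,
  [/\ below C (nth 0 v 1) (nth 0 v 0), below C (nth 0 v 2) b & D (nth 0 v 0, b)])).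
apply: (@sigma1_ex _ (fun v =>
  [/\ below C (nth 0 v 2) (nth 0 v 1), below C (nth 0 v 3) (nth 0 v 0)
    & D (nth 0 v 1, nth 0 v 0)])).
have var4 i : i < 4 -> recfun 4 (fun v => nth 0 v i) by exact: recfun_var.
apply: sigma1_ext (sigma1_and (sigma1_and
  (sigma1_below hC (var4 2 isT) (var4 1 isT))
  (sigma1_below hC (var4 3 isT) (var4 0 isT)))
  (sigma1_ce2 hD (var4 1 isT) (var4 0 isT))) _.
by move=> v _; split=> [[[]]|[]].
Qed.

(* T j will say that [j] indexes a cover of S; W lists, for each label l, the
   basic sets below which the members labelled l must lie. *)
Definition certified (br : nat -> set nat) (T : set nat) (C D : set (nat * nat))
    (W conf : seq (nat * nat)) (i : nat) :=
  exists j (lab : nat -> nat), [/\ T j,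
    forall p, br j p ->
      p = i \/ exists2 c, c \in W & lab p = c.1 /\ below C p c.2 &
    forall p q, br j p -> br j q -> (lab p, lab q) \in conf -> apart C D p q].

Lemma certified_ce br T C D W conf : finite_subsets_enum br -> ce_set1 T ->
  ce_set2 C -> ce_set2 D -> ce_set1 (certified br T C D W conf).
Proof.
move=> [_ cbr [phi cphi hphi]] hT hC hD; apply: ce_sigma1.
have hbr k A B : recfun k A -> recfun k B ->
    recpred k (fun v => ~~ `[< br (A v) (B v) >]).
  move=> hA hB; apply: recpred_neg.
  apply: (@recfun_op2 _ (fun x y => `[< br x y >] : nat)) => //.
  by case: cbr => c hc; exists c => v; have := hc v; rewrite /= !(tnth_nth 0).
have var k i : i < k -> recfun k (fun v => nth 0 v i) by exact: recfun_var.
have hB k i : i < k -> recfun k (fun v => (phi (nth 0 v i)).+1).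
  by move=> ik; apply/recfun_succ/recfun_computable1 => //; exact: var.
(* The labelling is replaced by a code [t] of its values up to [phi j], a bound for the members of
   [br j]; implications with decidable premises become disjunctions. *)
apply: sigma1_ext (_ : sigma1 1 (fun v => exists j, exists t, [/\ T j,
    forall p, p < (phi j).+1 -> ~~ `[< br j p >] \/ (p == nth 0 v 0 \/
      exists2 c, c \in W & lnth p t == c.1 /\ below C p c.2) &
    forall p, p < (phi j).+1 -> forall q, q < (phi j).+1 ->
      ~~ `[< br j p >] || ~~ `[< br j q >] || ((lnth p t, lnth q t) \notin conf)
      \/ apart C D p q])) _.
  apply: (@sigma1_ex _ (fun v => exists t, [/\ T (nth 0 v 0),
    forall p, p < (phi (nth 0 v 0)).+1 -> ~~ `[< br (nth 0 v 0) p >] \/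
      (p == nth 0 v 1 \/
      exists2 c, c \in W & lnth p t == c.1 /\ below C p c.2) &
    forall p, p < (phi (nth 0 v 0)).+1 -> forall q, q < (phi (nth 0 v 0)).+1 ->
      ~~ `[< br (nth 0 v 0) p >] || ~~ `[< br (nth 0 v 0) q >] ||
      ((lnth p t, lnth q t) \notin conf) \/ apart C D p q])).
  apply: (@sigma1_ex _ (fun v => [/\ T (nth 0 v 1),
    forall p, p < (phi (nth 0 v 1)).+1 -> ~~ `[< br (nth 0 v 1) p >] \/
      (p == nth 0 v 2 \/
      exists2 c, c \in W & lnth p (nth 0 v 0) == c.1 /\ below C p c.2) &
    forall p, p < (phi (nth 0 v 1)).+1 -> forall q, q < (phi (nth 0 v 1)).+1 ->
      ~~ `[< br (nth 0 v 1) p >] || ~~ `[< br (nth 0 v 1) q >] ||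
      ((lnth p (nth 0 v 0), lnth q (nth 0 v 0)) \notin conf) \/ apart C D p q])).
  have h2 : sigma1 3 (fun v => forall p, p < (phi (nth 0 v 1)).+1 ->
      ~~ `[< br (nth 0 v 1) p >] \/ (p == nth 0 v 2 \/
      exists2 c, c \in W & lnth p (nth 0 v 0) == c.1 /\ below C p c.2)).
    apply: (@sigma1_ball _ (fun v => ~~ `[< br (nth 0 v 2) (nth 0 v 0) >] \/
      (nth 0 v 0 == nth 0 v 3 \/ exists2 c, c \in W &
        lnth (nth 0 v 0) (nth 0 v 1) == c.1 /\ below C (nth 0 v 0) c.2))).
      apply: sigma1_or; first by apply: sigma1_rec; apply: hbr; exact: var.
      apply: sigma1_or; first by apply: sigma1_rec; apply: recpred_eq; exact: var.
      apply: sigma1_seq => c; apply: sigma1_andrec.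
        by apply: recpred_eq; [apply: recfun_lnth; exact: var|exact: recfun_const].
      by apply: sigma1_below => //; [exact: var|exact: recfun_const].
    exact: hB.
  have h3 : sigma1 3 (fun v => forall p, p < (phi (nth 0 v 1)).+1 ->
      forall q, q < (phi (nth 0 v 1)).+1 ->
      ~~ `[< br (nth 0 v 1) p >] || ~~ `[< br (nth 0 v 1) q >] ||
      ((lnth p (nth 0 v 0), lnth q (nth 0 v 0)) \notin conf) \/ apart C D p q).
    apply: (@sigma1_ball _ (fun v => forall q, q < (phi (nth 0 v 2)).+1 ->
      ~~ `[< br (nth 0 v 2) (nth 0 v 0) >] || ~~ `[< br (nth 0 v 2) q >] ||
      ((lnth (nth 0 v 0) (nth 0 v 1), lnth q (nth 0 v 1)) \notin conf)
      \/ apart C D (nth 0 v 0) q)); last exact: hB.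
    apply: (@sigma1_ball _ (fun v =>
      ~~ `[< br (nth 0 v 3) (nth 0 v 1) >] || ~~ `[< br (nth 0 v 3) (nth 0 v 0) >] ||
      ((lnth (nth 0 v 1) (nth 0 v 2), lnth (nth 0 v 0) (nth 0 v 2)) \notin conf)
      \/ apart C D (nth 0 v 1) (nth 0 v 0))); last exact: hB.
    apply: sigma1_or; last by apply: sigma1_apart => //; exact: var.
    apply: sigma1_rec; apply: recpred_or.
      by apply: recpred_or; apply: hbr; exact: var.
    by apply: recpred_neg; apply: recpred_mem2; apply: recfun_lnth; exact: var.
  apply: sigma1_ext (sigma1_and (sigma1_and (sigma1_ce1 hT (var 3 1 isT)) h2) h3) _.
  by move=> v _; split=> [[[]]|[]].
move=> v _; move: (nth 0 v 0) => i; split.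
  move=> [j [t [Tj h1 h2]]]; exists j, (lnth^~ t); split => // [p jp|p q jp jq pq].
    have := h1 p (hphi _ _ jp); rewrite asboolT//= => -[//|[/eqP->|]]; first by left.
    by move=> [c cW [/eqP? ?]]; right; exists c.
  have := h2 p (hphi _ _ jp) q (hphi _ _ jq).
  by rewrite !asboolT//= pq => -[].
move=> [j [lab [Tj h1 h2]]]; have [t ht] := lnth_surj lab (phi j).+1.
exists j, t; split => // [p pj|p pj q qj].
  case: (asboolP (br j p)) => jp; last by left.
  right; have [->|[c cW [e ?]]] := h1 _ jp; first by left; rewrite eqxx.
  by right; exists c => //; rewrite ht// e.
case: (asboolP (br j p)) => jp; last by left.
case: (asboolP (br j q)) => jq; last by left.
rewrite !ht//=; case: (boolP (_ \in conf)) => pq; last by left.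
by right; apply: h2.
Qed.

(** * Mod 2 cochains on a grid *)

Local Open Scope ring_scope.

Section grid.
Context {n : nat}.
Local Notation pt := ('I_n -> nat).

Definition upd (p : pt) (i : 'I_n) (t : nat) : pt :=
  fun j => if j == i then t else p j.

Definition step (p : pt) (i : 'I_n) : pt := upd p i (p i).+1.

Lemma updC (p : pt) i j t u : i != j ->
  upd (upd p i t) j u = upd (upd p j u) i t.
Proof.
move=> ij; apply/funext => k; rewrite /upd.
by case: (eqVneq k j) => // ->; rewrite eq_sym (negbTE ij).
Qed.

Lemma upd_upd (p : pt) i t u : upd (upd p i t) i u = upd p i u.
Proof. by apply/funext => k; rewrite /upd; case: eqP. Qed.

Lemma upd_same (p : pt) i t : upd p i t i = t.
Proof. by rewrite /upd eqxx. Qed.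

Lemma stepC (p : pt) i j : step (step p i) j = step (step p j) i.
Proof.
case: (eqVneq i j) => [-> //|ij]; apply/funext => k; rewrite /step /upd.
have ji := ij; rewrite eq_sym in ji; rewrite (negbTE ij) (negbTE ji).
by case: (eqVneq k j) => // ->; rewrite (negbTE ji).
Qed.

Lemma step_upd (p : pt) i t : step (upd p i t) i = upd p i t.+1.
Proof. by rewrite /step upd_same upd_upd. Qed.

(* The coefficient, on the coordinates A, of the cup product of the mod 2
   coboundaries of the 0-cochains b k, k in s. *)
Fixpoint cupd (b : 'I_n -> pt -> 'F_2) (s : seq 'I_n) (A : {set 'I_n}) (p : pt)
    : 'F_2 :=
  if s is k :: s' then
    \sum_(i in A) (b k (step p i) - b k p) * cupd b s' (A :\ i)%SET (step p i)
  else 1.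

(** The terms for [(i, j)] and [(j, i)] cancel in characteristic 2. *)
Lemma sum_sym_F2 (A : {set 'I_n}) (f : 'I_n -> 'I_n -> 'F_2) :
  (forall i j, f i j = f j i) ->
  \sum_(i in A) \sum_(j in (A :\ i)%SET) f i j = 0.
Proof.
move=> fC.
have E i : \sum_(j in (A :\ i)%SET) f i j =
   \sum_(j in A | (i < j)%N) f i j + \sum_(j in A | (j < i)%N) f i j.
  rewrite (bigID (fun j : 'I_n => (i < j)%N)) /=; congr (_ + _).
  - apply: eq_bigl => j; rewrite !inE; case: (eqVneq j i) => [->|//].
    by rewrite ltnn !andbF.
  - apply: eq_bigl => j; rewrite !inE -leqNgt ltn_neqAle -val_eqE /=.
    by rewrite andbCA andbA.
rewrite (eq_bigr _ (fun i _ => E i)) big_split /=.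
rewrite [X in _ + X](exchange_big_dep (fun j => j \in A)) /=; last first.
  by move=> i j _ /andP[].
rewrite -big_split /=; apply: big1 => i iA.
under [X in _ + X]eq_bigr do rewrite fC.
have -> : \sum_(j in A | (i \in A) && (i < j)%N) f i j =
          \sum_(j in A | (i < j)%N) f i j by apply: eq_bigl => j; rewrite iA.
by apply: (@addrr_pchar2 'F_2); rewrite pchar_Fp.
Qed.

(** A cup product of coboundaries is a cocycle, by induction on the number of factors. *)
Lemma cupd_closed b s (A : {set 'I_n}) p :
  \sum_(i in A) (cupd b s (A :\ i)%SET (step p i) - cupd b s (A :\ i)%SET p) = 0.
Proof.
elim: s A p => [|k s IH] A p /=.
  by apply: big1 => i _; rewrite subrr.
pose G i j := cupd b s (A :\ i :\ j)%SET (step (step p i) j).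
pose H i j := cupd b s (A :\ i :\ j)%SET (step p j).
have setDC (i j : 'I_n) : (A :\ i :\ j)%SET = (A :\ j :\ i)%SET.
  by rewrite !finset.setDDl finset.setUC.
(* Discrete Leibniz rule: the first sum carries the second difference of [b k], symmetric in [i] and
   [j], and vanishes mod 2; the second reduces to the shorter product. *)
have E i : i \in A ->
    \sum_(j in (A :\ i)%SET) (b k (step (step p i) j) - b k (step p i)) * G i j -
    \sum_(j in (A :\ i)%SET) (b k (step p j) - b k p) * H i j =
    \sum_(j in (A :\ i)%SET)
       (b k (step (step p i) j) - b k (step p i) - b k (step p j) + b k p) * G i j
    + \sum_(j in (A :\ i)%SET) (b k (step p j) - b k p) * (G i j - H i j).
  move=> _; rewrite -sumrB -big_split /=; apply: eq_bigr => j _; ring.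
rewrite (eq_bigr _ E) big_split /= sum_sym_F2 ?add0r; last first.
  move=> i j; rewrite /G (setDC i j) (stepC p i j); congr (_ * _); ring.
rewrite (exchange_big_dep (fun j => j \in A)) /=; last first.
  by move=> i j _; rewrite !inE => /andP[].
apply: big1 => j jA; rewrite -mulr_sumr.
rewrite [X in _ * X](_ : _ = 0) ?mulr0 //.
rewrite -[RHS](IH (A :\ j)%SET (step p j)); apply: eq_big => [i|i _].
  by rewrite !inE jA eq_sym andbT andbC.
by rewrite /G /H (setDC i j) (stepC p i j).
Qed.

Definition in_cube (A : {set 'I_n}) (p q : pt) :=
  forall i, (p i <= q i <= (p i).+1)%N && ((i \notin A) ==> (q i == p i)).

Lemma in_cube_refl A p : in_cube A p p.
Proof. by move=> i; rewrite leqnn leqnSn eqxx implybT. Qed.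

Lemma in_cube_step (A : {set 'I_n}) p q i :
  i \in A -> in_cube (A :\ i)%SET (step p i) q -> in_cube A p q.
Proof.
move=> iA h j; move: (h j); rewrite !inE /step /upd; case: (eqVneq j i) => /=.
  by move=> -> /andP[_ /eqP->]; rewrite iA leqnSn leqnn.
by [].
Qed.

Lemma in_cube_step1 (A : {set 'I_n}) p i : i \in A -> in_cube A p (step p i).
Proof. by move=> iA; apply: in_cube_step iA _; apply: in_cube_refl. Qed.

(** Only values at vertices of the cube enter the coefficient, so a cochain constant there
    contributes zero differences. *)
Lemma cupd_eq0 b s (A : {set 'I_n}) p i : i \in s ->
  (forall q, in_cube A p q -> b i q = b i p) -> cupd b s A p = 0.
Proof.
elim: s A p => // k s IH A p; rewrite inE => /predU1P[<- h|ins h] /=.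
  by apply: big1 => j jA; rewrite h ?subrr ?mul0r//; apply: in_cube_step1.
apply: big1 => j jA; rewrite (IH _ _ ins) ?mulr0// => q cq.
by rewrite !h//; [apply: in_cube_step1|apply: in_cube_step cq].
Qed.

(** Only the coordinates of [p] outside [s] matter; thus a sum over a face is again a box sum. *)
Fixpoint box_sum (N : nat) (s : seq 'I_n) (F : pt -> 'F_2) (p : pt) : 'F_2 :=
  if s is i :: s' then \sum_(t < N) box_sum N s' F (upd p i t) else F p.

Lemma eq_box_sum N s F G p : F =1 G -> box_sum N s F p = box_sum N s G p.
Proof. by move=> /funext->. Qed.

Lemma box_sum_sum N s (J : Type) (r : seq J) (P : pred J) F p :
  box_sum N s (fun q => \sum_(j <- r | P j) F j q) p =
  \sum_(j <- r | P j) box_sum N s (F j) p.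
Proof.
elim: s p => //= i s IH p; rewrite exchange_big /=.
by apply: eq_bigr => t _; rewrite IH.
Qed.

Lemma box_sum0 N s p : box_sum N s (fun _ => 0) p = 0.
Proof. by elim: s p => //= i s IH p; apply: big1. Qed.

Lemma box_sum_upd N s F p i t : i \notin s ->
  box_sum N s F (upd p i t) = box_sum N s (fun q => F (upd q i t)) p.
Proof.
elim: s p => //= j s IH p; rewrite inE negb_or => /andP[ij ins].
by apply: eq_bigr => u _; rewrite updC// IH.
Qed.

Lemma box_sum_rem N s F p i : uniq s -> i \in s ->
  box_sum N s F p = box_sum N (rem i s) (fun q => \sum_(t < N) F (upd q i t)) p.
Proof.
elim: s p => //= j s IH p /andP[js us]; rewrite inE eq_sym.
case: eqP js => [-> js _|/eqP ji _ /= ins]; last by apply: eq_bigr => t _; rewrite IH.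
rewrite box_sum_sum; apply: eq_bigr => t _.
by rewrite box_sum_upd.
Qed.

(** Telescoping along coordinate [i] leaves the two opposite faces: Stokes in one direction. *)
Lemma box_sum_diff N s F p i : uniq s -> i \in s ->
  box_sum N s (fun q => F (step q i) - F q) p =
  box_sum N (rem i s) (fun q => F (upd q i N) - F (upd q i 0%N)) p.
Proof.
move=> us ins; rewrite (box_sum_rem N _ _ us ins); apply: eq_box_sum => q.
under eq_bigr do rewrite step_upd.
rewrite -(big_mkord xpredT (fun t => F (upd q i t.+1) - F (upd q i t))).
by rewrite telescope_sumr.
Qed.

Lemma box_sum_neq0 N s F p : box_sum N s F p != 0 ->
  exists q, (forall i, i \in s -> (q i < N)%N) /\ F q != 0.
Proof.
(* Induction needs the coordinates outside [s] unchanged: a leading coordinate absent from the tail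
   keeps the value of its summation index. *)
suff: box_sum N s F p != 0 -> exists q, [/\ forall i, i \in s -> (q i < N)%N,
    forall i, i \notin s -> q i = p i & F q != 0].
  by move=> h /h [q [? _ ?]]; exists q.
elim: s p => [|i s IH] p /= h; first by exists p.
have [t] : exists t : 'I_N, box_sum N s F (upd p i t) != 0.
  by apply/existsP; apply: contraNT h => /existsPn h; rewrite big1// => t _;
    apply/eqP; move: (h t); rewrite negbK.
move=> /IH[q [q1 q2 q3]]; exists q; split => // j; rewrite inE.
  case/orP => [/eqP->|]; last exact: q1.
  have [/q1 //|/q2 ->] := boolP (i \in s); by rewrite upd_same.
by rewrite negb_or => /andP[ji /q2 ->]; rewrite /upd (negbTE ji).
Qed.

(* Closedness turns the integrand into a sum of partial differences; after
   telescoping only the face p k = N survives. *)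
Lemma box_sum_cupd N (b : 'I_n -> pt -> 'F_2) s p :
  (forall i q, q i = 0%N -> b i q = 0) -> (forall i q, q i = N -> b i q = 1) ->
  uniq s -> (forall i, i \notin s -> p i = N) ->
  box_sum N s (cupd b s [set i in s]%SET) p = 1.
Proof.
move=> b0 b1; elim: s p => [|k s IH] p // us pN.
set A := [set i in k :: s]%SET.
have AE i : (i \in A) = (i \in k :: s) by rewrite inE.
pose F i q := b k q * cupd b s (A :\ i)%SET q.
have E q : cupd b (k :: s) A q = \sum_(i in A) (F i (step q i) - F i q).
  (* The zero added is [b k q] times the cocycle relation of the shorter product. *)
  rewrite /= -[LHS]addr0 -[X in _ + X = _](mulr0 (b k q)).
  rewrite -[X in _ + _ * X = _](cupd_closed b s A q).
  rewrite mulr_sumr -big_split /=; apply: eq_bigr => i iA; rewrite /F; ring.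
rewrite (eq_box_sum N _ _ E) box_sum_sum (bigD1 k) /=; last by rewrite AE mem_head.
rewrite -[X in X + _]/(box_sum N (k :: s) (fun q => F k (step q k) - F k q) p).
rewrite box_sum_diff ?mem_head// [rem _ _]/= eqxx.
have Ak : (A :\ k)%SET = [set i in s]%SET.
  apply/setP => i; rewrite !inE; case: (eqVneq i k) => //= ->.
  by case/andP: us => /negbTE->.
rewrite (@eq_box_sum N s _ (fun q => cupd b s [set i in s]%SET (upd q k N))); last first.
  by move=> q; rewrite /F b1 ?upd_same// b0 ?upd_same// Ak; ring.
case/andP: (us) => ks us'.
rewrite -box_sum_upd// IH//; last first.
  move=> i ins; rewrite /upd; case: eqP => // ik; apply: pN.
  by rewrite inE negb_or ins andbT; apply/eqP.
rewrite big1 ?addr0// => i /andP[iA ik].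
rewrite -[LHS]/(box_sum N (k :: s) (fun q => F i (step q i) - F i q) p).
rewrite box_sum_diff//; last by rewrite -AE.
rewrite -[RHS](box_sum0 N (rem i (k :: s)) p); apply: eq_box_sum => q.
have ins : i \in s by move: iA; rewrite AE inE (negbTE ik).
(* On both faces in a direction [i] of [s], [b i] is constant, so the product, having it as a
   factor, vanishes. *)
have F0 t c : (forall q : pt, q i = t -> b i q = c) -> F i (upd q i t) = 0.
  move=> h; rewrite /F (cupd_eq0 ins) ?mulr0// => q' /(_ i).
  rewrite !inE eqxx /= upd_same => /andP[_ /eqP q'i].
  by rewrite !h// upd_same.
by rewrite (F0 _ 1 (b1 i)) (F0 _ 0 (b0 i)) subrr.
Qed.

(** A combinatorial Poincaré-Miranda theorem: the coefficients sum to 1, so one of them is nonzero,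
    and [cupd_eq0] applies to its cube. *)
Lemma discrete_miranda N (b : 'I_n -> pt -> bool) :
  (forall i q, q i = 0%N -> b i q = false) -> (forall i q, q i = N -> b i q) ->
  exists p : pt, (forall i, (p i < N)%N) /\
    forall i, exists q, (forall j, (p j <= q j <= (p j).+1)%N) /\ b i q != b i p.
Proof.
move=> b0 b1; pose c i q : 'F_2 := (b i q)%:R.
have : box_sum N (enum 'I_n) (cupd c (enum 'I_n) [set i in enum 'I_n]%SET)
    (fun=> N) = 1.
  apply: box_sum_cupd; rewrite ?enum_uniq//.
    by move=> i q /b0; rewrite /c => ->.
  by move=> i q /b1; rewrite /c => ->.
move=> E; have : box_sum N (enum 'I_n) (cupd c (enum 'I_n)
  [set i in enum 'I_n]%SET) (fun=> N) != 0 by rewrite E.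
move=> /box_sum_neq0[p [pN nz]]; exists p; split => [i|i].
  by apply: pN; rewrite mem_enum.
apply/not_existsP => h; move: nz; rewrite (@cupd_eq0 _ _ _ _ i) ?eqxx ?mem_enum//.
move=> q cq; rewrite /c; congr (_ _); case: (eqVneq (b i q) (b i p)) => [->//|ne].
by case: (h q); split => // j; case/andP: (cq j).
Qed.

End grid.

(** * The covering theorem for the cube *)

Definition cube (R : realType) (n : nat) (r : R) : set 'rV[R]_n :=
  [set v | forall i, `|v ord0 i| <= r].

Lemma ball_rV (R : realType) n (v w : 'rV[R]_n) (e : R) : 0 < e ->
  ball v e w <-> forall i, `|v ord0 i - w ord0 i| < e.
Proof.
move=> e0; split=> [[_ h] i|h]; first exact: (h ord0 i).
by split=> // i j; rewrite ord1; exact: h.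
Qed.

Lemma cube_compact (R : realType) n (r : R) : compact (@cube R n r).
Proof.
have := @rV_compact R n (fun=> [set` `[- r, r]]) (fun=> @segment_compact R _ _).
congr (compact _); apply/seteqP; split=> v h i; move: (h i);
  by rewrite /= in_itv /= ler_norml.
Qed.

Lemma cube_not_covered (R : realType) n (U V : 'I_n -> set 'rV[R]_n) :
  (forall k, open (U k)) -> (forall k, open (V k)) ->
  (forall k v, cube 1 v -> U k v -> V k v -> False) ->
  (forall k v, cube 1 v -> v ord0 k = 1 -> ~ U k v) ->
  (forall k v, cube 1 v -> v ord0 k = -1 -> ~ V k v) ->
  ~ (forall v, cube 1 v -> exists k, U k v \/ V k v).
Proof.
move=> oU oV UV U1 V1 cov.
(* The radius is twice the mesh [2 / N.+1] of the grid used below, so the open ball at a vertex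
   contains the adjacent grid points. *)
pose near_in (N : nat) v (A : set 'rV[R]_n) :=
  forall w, ball v (4 / N.+1%:R) w -> A w.
have /compact_near_coveringP nc := @cube_compact R n 1.
have near_in_open A v : open A -> A v ->
    \forall v' \near v & N \near \oo, near_in N v' A.
  move=> oA Av; have /nbhs_ballP[e /= e0 eA] : nbhs v A by exact: open_nbhs_nbhs.
  have e20 : 0 < e / 2 by rewrite divr_gt0.
  exists (ball v (e / 2), [set N : nat | 4 / N.+1%:R < e / 2]); last first.
    move=> [v' N] /= [vv' Ne] w v'w; apply: eA.
    rewrite [e]splitr; apply: ball_triangle vv' _.
    by apply: le_ball v'w; exact: ltW.
  split => /=; first exact: nbhsx_ballx.
  have := @near_infty_natSinv_lt R (PosNum (divr_gt0 e20 (ltr0n R 4))).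
  apply: filterS => N /=; rewrite ltr_pdivlMr// mulrC.
  by apply: le_lt_trans.
(* Lebesgue number argument: compactness makes one [N] serve all points of the cube. *)
have /nc : forall v, cube 1 v -> \forall v' \near v & N \near \oo,
    exists k, near_in N v' (U k) \/ near_in N v' (V k).
  move=> v /cov[k [Uv|Vv]].
    by apply: filterS (near_in_open _ _ (oU k) Uv) => -[v' N] /= ?; exists k; left.
  by apply: filterS (near_in_open _ _ (oV k) Vv) => -[v' N] /= ?; exists k; right.
move=> [N0 _ /(_ N0 (leqnn _))]; set N := N0.+1 => /= covN.
(* The grid is mapped affinely onto [-1,1]^n; truncation at [N] keeps every [x p] in the cube. *)
pose x (p : 'I_n -> nat) : 'rV[R]_n :=
  \row_i (2 * (minn (p i) N)%:R / N%:R - 1).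
have N_gt0 : 0 < N%:R :> R by rewrite ltr0n.
have xE p i : x p ord0 i = 2 * (minn (p i) N)%:R / N%:R - 1 by rewrite mxE.
have cx p : cube 1 (x p).
  move=> i; rewrite xE ler_norml lerBrDr addrC subrr.
  rewrite divr_ge0 ?mulr_ge0// lerBlDr -natr1 ?mulr1n /=.
  have : (minn (p i) N)%:R <= N%:R :> R by rewrite ler_nat geq_minr.
  by move=> h; rewrite ler_pdivrMr//; lra.
(* Points of [U k] get bit 0; the face [p k = 0] is given bit 0 as well, which does not affect [V k]
   as it misses that face. *)
pose b k p := ~~ `[< U k (x p) >] && (p k != 0%N).
have [||p [pN pb]] := @discrete_miranda n N b.
- by move=> k q qk; rewrite /b qk eqxx andbF.
- move=> k q qk; rewrite /b qk andbT; apply/asboolPn; apply: U1 => //.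
  by rewrite xE qk minnn mulfK ?gt_eqF//; lra.
(* The vertices of the cube found all lie in one [U k] or all in one [V k]; either way [b k] is
   constant on them, a contradiction. *)
have [k h] := covN _ (cx p).
have [q [pq]] := pb k; apply/negP; rewrite negbK.
have nearq r : (forall j, p j <= r j <= (p j).+1)%N -> ball (x p) (4 / N%:R) (x r).
  move=> pr; apply/ball_rV; first by rewrite divr_gt0.
  move=> i; rewrite !xE opprB addrA subrK -mulrBl -mulrBr !normrM.
  rewrite normfV (gtr0_norm N_gt0) ltr_pM2r ?invr_gt0// normr_nat.
  case/andP: (pr i) => p1 p2; have := pN i => pNi.
  have -> : minn (p i) N = p i by lia.
  suff : `|(p i)%:R - (minn (r i) N)%:R| <= 1 :> R by lra.
  have : (minn (r i) N = p i \/ minn (r i) N = (p i).+1)%N by lia.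
  case=> ->; first by rewrite subrr normr0.
  by rewrite -natr1 opprD addrA subrr add0r normrN normr1.
have pp j : (p j <= p j <= (p j).+1)%N by rewrite leqnn leqnSn.
apply/eqP; rewrite /b; case: h => h.
  rewrite (asboolT (h _ (nearq _ pq))).
  by rewrite (asboolT (h _ (nearq _ pp))).
have bV r : (forall j, p j <= r j <= (p j).+1)%N -> b k r.
  move=> /nearq /h Vr; rewrite /b; apply/andP; split.
    by apply/asboolPn => Ur; apply: (UV k (x r)).
  apply/eqP => rk; apply: (V1 k (x r)) => //.
  by rewrite xE rk min0n mulr0 mul0r sub0r.
by rewrite -!/(b k _) !bV.
Qed.

(** * Formal separation of compact sets and charts *)

(** Near-covering compactness is applied to the filter of finite lists of admissible indices,
    directed by inclusion. *)
Lemma compact_seq_cover (T : topologicalType) (J : eqType) (K : set T)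
    (P : set J) (f : J -> set T) :
  compact K -> (forall x, K x -> exists j, [/\ P j, open (f j) & f j x]) ->
  exists s : seq J, (forall j, j \in s -> P j) /\
    forall x, K x -> exists2 j, j \in s & f j x.
Proof.
move=> /compact_near_coveringP cK cov.
pose B (s : seq J) := [set s' : seq J | {subset s <= s'} /\ forall j, j \in s' -> P j].
pose F := filter_from [set s : seq J | forall j, j \in s -> P j] B.
have FF : Filter F.
  apply: filter_from_filter; first by exists [::].
  move=> s1 s2 h1 h2; exists (s1 ++ s2).
    by move=> j; rewrite mem_cat => /orP[/h1|/h2].
  by move=> s [ss hs]; split; split => // j js; apply: ss; rewrite mem_cat js ?orbT.
have [] := cK _ F (fun s x => (forall j, j \in s -> P j) /\
    exists2 j, j \in s & f j x) FF.
  move=> x /cov[j [Pj oj fjx]].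
  exists (f j, B [:: j]); last first.
    move=> [x' s] /= [fx' [js Ps]]; split => //; exists j => //.
    by apply: js; rewrite mem_head.
  split => /=; first exact: open_nbhs_nbhs.
  by exists [:: j] => // i; rewrite inE => /eqP->.
move=> s Ps /(_ s (conj (fun _ => id) Ps)) sK; exists s; split => // x Kx.
by have [_] := sK x Kx.
Qed.

Section formal.
Context {X : topologicalType} (I : nat -> set X) (C D : set (nat * nat)).
Hypothesis basisI : basis (range I).
Hypothesis D_disj : forall i j, D (i, j) -> I i `&` I j = set0.
Hypothesis C_sub : forall i j, C (i, j) -> I i `<=` I j.
Hypothesis D_sep : forall x y, x <> y -> exists i j, [/\ I i x, I j y & D (i, j)].
Hypothesis C_meet : forall i j x, I i x -> I j x ->
  exists k, [/\ I k x, C (k, i) & C (k, j)].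

Lemma basis_open i : open (I i).
Proof. by case: basisI => + _; apply; exists i. Qed.

Lemma basis_nbhs x (A : set X) : nbhs x A -> exists2 i, I i x & I i `<=` A.
Proof. by move=> /(basisI.2 x)[_ [[i _ <-] ix] iA]; exists i. Qed.

Lemma formal_hausdorff : hausdorff_space X.
Proof.
rewrite open_hausdorff => x y /eqP /D_sep[i [j [ix jy /D_disj ij]]].
exists (I i, I j); first by rewrite !inE.
by split; rewrite /= ?ij//; exact: basis_open.
Qed.

Lemma below_sub p q : below C p q -> I p `<=` I q.
Proof.
move=> [s ps <-]; elim: s p ps => [p _ x//|r s IH p /andP[/asboolP/C_sub pr /IH rs]].
exact: subset_trans pr rs.
Qed.

Lemma apart_disj p q x : apart C D p q -> I p x -> I q x -> False.
Proof.
move=> [a [b [/below_sub pa /below_sub qb /D_disj ab]]] /pa ax /qb bx.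
by have : (I a `&` I b) x by []; rewrite ab.
Qed.

(** Iterating [C_meet] adds one link to each chain per round, whence [below] and not [C]. *)
Lemma formal_meet (s : seq nat) x : (forall i, i \in s -> I i x) ->
  exists2 k, I k x & forall i, i \in s -> below C k i.
Proof.
elim: s => [_|i s IH h].
  by have [k kx _] := basis_nbhs (@filterT _ (nbhs x) _); exists k.
have [k kx ks] : exists2 k, I k x & forall i, i \in s -> below C k i.
  by apply: IH => j js; apply: h; rewrite inE js orbT.
have [l [lx li lk]] := C_meet (h i (mem_head _ _)) kx.
exists l => // j; rewrite inE => /predU1P[->|/ks]; first exact: below1.
by apply: below_trans; exact: below1.
Qed.

(** Compact sets are closed here, so basic sets inside the complement of [F] cover [K]. The lists
    obtained become fixed finite data of a certificate. *)
Lemma cover_avoiding (K F : set X) : compact K -> compact F ->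
  (forall x, K x -> ~ F x) ->
  exists w : seq nat, (forall q x, q \in w -> F x -> ~ I q x) /\
    forall x, K x -> exists2 q, q \in w & I q x.
Proof.
move=> cK /(compact_closed formal_hausdorff) cF KF.
have [x Kx|w [h1 h2]] := @compact_seq_cover _ _ K
    (fun q => forall x, F x -> ~ I q x) I cK.
  have /basis_nbhs[i ix iF] : nbhs x (~` F).
    by apply: open_nbhs_nbhs; split; [exact: closed_openC|exact: KF].
  by exists i; split => [y Fy /iF||]//; exact: basis_open.
by exists w; split => // q x /h1; exact.
Qed.

(** The classical separation of disjoint compact sets in a Hausdorff space, carried out with formal
    relations; downward closure of [P] and [Q] allows the refinements. *)
Lemma formal_separation (A B : set X) (P Q : nat -> Prop) :
  compact A -> compact B -> (forall x, A x -> ~ B x) ->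
  (forall p q, below C p q -> P q -> P p) ->
  (forall p q, below C p q -> Q q -> Q p) ->
  (forall x, A x -> exists2 p, P p & I p x) ->
  (forall x, B x -> exists2 p, Q p & I p x) ->
  exists u v : seq nat, [/\ forall p, p \in u -> P p, forall q, q \in v -> Q q,
    forall x, A x -> exists2 p, p \in u & I p x,
    forall x, B x -> exists2 q, q \in v & I q x &
    forall p q, p \in u -> q \in v -> apart C D p q].
Proof.
move=> cA cB AB downP downQ AP BQ.
(* A point is first separated from [B]: finitely many sets cover [B], and their partners at [y] are
   refined to one. *)
have pointwise y : A y -> exists pv : nat * seq nat, [/\ P pv.1, I pv.1 y,
    forall z, B z -> exists2 q, q \in pv.2 & I q z &
    forall q, q \in pv.2 -> apart C D pv.1 q].
  move=> Ay; have [z Bz|v [h1 h2]] := @compact_seq_cover _ _ B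
      (fun q => exists2 i, I i y & apart C D i q) I cB.
    have yz : y <> z by move=> e; apply: (AB y Ay); rewrite e.
    have [i [j [iy jz ij]]] := D_sep yz.
    exists j; split => //; last exact: basis_open.
    by exists i => //; exists i, j; split => //; exact: below_refl.
  have /choice[i hi] : forall q, exists i, q \in v -> I i y /\ apart C D i q.
    move=> q; case: (boolP (q \in v)) => [/h1[i ? ?]|_]; first by exists i.
    by exists 0%N.
  have [p Pp py] := AP y Ay.
  have [|k ky hk] := @formal_meet (p :: map i v) y.
    by move=> j; rewrite inE => /predU1P[->//|/mapP[q /hi[? _] ->]].
  exists (k, v); split => //=; first by apply: downP Pp; apply: hk; rewrite mem_head.
  move=> q qv; apply: apart_below (hi q qv).2 _ (below_refl _ _).
  by apply: hk; rewrite inE map_f ?orbT.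
have [y Ay|L [L1 L2]] := @compact_seq_cover _ _ A
    (fun pv : nat * seq nat => [/\ P pv.1,
      forall z, B z -> exists2 q, q \in pv.2 & I q z &
      forall q, q \in pv.2 -> apart C D pv.1 q]) (fun pv => I pv.1) cA.
  have [pv [? ? ? ?]] := pointwise y Ay.
  by exists pv; split => //; exact: basis_open.
(* Each [z] in [B] selects one set from every list in [L]; a common refinement is apart from all
   chosen neighbourhoods covering [A]. *)
have [z Bz|v [v1 v2]] := @compact_seq_cover _ _ B
    (fun r => Q r /\ forall pv, pv \in L -> apart C D pv.1 r) I cB.
  have /choice[q hq] : forall pv, exists q, pv \in L -> I q z /\ apart C D pv.1 q.
    move=> pv; case: (boolP (pv \in L)) => [/L1[_ /(_ z Bz)[q qv ?] h]|_].
      by exists q => _; split => //; exact: h.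
    by exists 0%N.
  have [p Qp pz] := BQ z Bz.
  have [|k kz hk] := @formal_meet (p :: map q L) z.
    by move=> j; rewrite inE => /predU1P[->//|/mapP[? /hq[? _] ->]].
  exists k; split => //; last exact: basis_open.
  split; first by apply: downQ Qp; apply: hk; rewrite mem_head.
  move=> pv pvL; apply: apart_below (hq pv pvL).2 (below_refl _ _) _.
  by apply: hk; rewrite inE map_f ?orbT.
exists [seq pv.1 | pv <- L], v; split => //.
- by move=> _ /mapP[pv /L1[? _ _] ->].
- by move=> q /v1[].
- by move=> x /L2[pv pvL ?]; exists pv.1 => //; exact: map_f.
- by move=> _ q /mapP[pv pvL ->] /v1[_]; exact.
Qed.

End formal.

(** * Charts of the manifold *)

Lemma subtype_open (X : topologicalType) (S : set X) (A : set (set_type S)) :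
  open A -> exists2 B : set X, open B & A = set_val @^-1` B.
Proof. by move=> [B oB <-]; exists B. Qed.

Lemma set_val_continuous (X : topologicalType) (S : set X) :
  continuous (set_val : set_type S -> X).
Proof. exact: (@initial_continuous S X set_val). Qed.

Lemma manifold_chart (R : realType) (n : nat) (X : topologicalType) (S : set X)
    (y : X) : manifold R n (set_type S) -> S y ->
  exists h : 'rV[R]_n -> X, [/\ continuous h, injective h, forall v, S (h v),
    h 0 = y & forall rho : R, 0 < rho <= 2 -> exists2 G, open G & forall x, S x ->
      (G x <-> exists2 v : 'rV[R]_n, (forall i, `|v ord0 i| < rho) & h v = x)].
Proof.
move=> hM Sy; pose y' : set_type S := exist _ y (mem_set Sy).
have [N Ny [f [g [fK gK cf cg]]]] := hM y'.
(* The domain [N] of the chart need not be open; [M] is open in [X] and its trace on [S] lies in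
   [N]. *)
have [M [oM My MN]] : exists M : set X, [/\ open M, M y &
    forall s : set_type S, M (set_val s) -> N s].
  move: Ny; rewrite nbhsE => -[A [/subtype_open[M oM ->] My] MN].
  by exists M; split.
have Ny' : N y' by apply: MN.
pose c0 := f (exist _ y' (mem_set Ny')).
pose G v : X := set_val (set_val (g v)).
have cG : continuous G.
  move=> v; apply: (@continuous_comp _ _ _ (fun v => set_val (g v)) set_val).
    apply: (@continuous_comp _ _ _ g set_val); first exact: cg.
    exact: set_val_continuous.
  exact: set_val_continuous.
have Gy : G c0 = y by rewrite /G /c0 fK.
have Ginj : injective G.
  by move=> v w /val_inj/val_inj e; rewrite -(gK v) e gK.
have /nbhs_ballP[e /= e0 eM] : nbhs c0 (G @^-1` M).
  by apply: cG; rewrite Gy; exact: open_nbhs_nbhs.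
(* With scale [e / 3], cubes of radius [rho <= 2] shrink to radius below [e] and are sent into
   [M]. *)
have r0 : 0 < e / 3 by rewrite divr_gt0.
set r := e / 3 in r0.
exists (fun v => G (c0 + r *: v)); split.
- have ca : continuous (fun v : 'rV[R]_n => c0 + r *: v).
    move=> v A /nbhs_ballP[d /= d0 dA]; apply/nbhs_ballP.
    have dr0 : 0 < d / r by rewrite divr_gt0.
    exists (d / r) => // w /(ball_rV _ _ dr0) vw; apply: dA; apply/ball_rV => // i.
    rewrite !mxE opprD addrACA subrr add0r -mulrBr normrM gtr0_norm// mulrC.
    by rewrite -ltr_pdivlMr.
  exact: (fun v => continuous_comp (ca v) (cG _)).
- move=> v w /Ginj /addrI; apply: scalerI; exact: lt0r_neq0.
- by move=> v; exact: set_valP.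
- by rewrite scaler0 addr0.
move=> rho /andP[rho0 rho2].
pose W := [set w : 'rV[R]_n | forall i, `|c0 ord0 i - w ord0 i| < r * rho].
have rr0 : 0 < r * rho by rewrite mulr_gt0.
have oW : open W.
  rewrite (_ : W = ball c0 (r * rho)); first exact: ball_open.
  by apply/seteqP; split=> w; rewrite ball_rV.
have /subtype_open[W1 /subtype_open[W2 oW2 ->] hW] : open (f @^-1` W).
  by apply: open_comp oW => ? _; exact: cf.
(* [W2] describes the cube only within [N]; the factor [M] forces points of [S] into [N]. *)
exists (W2 `&` M); first exact: openI.
move=> x Sx; split.
  move=> [W2x Mx]; pose s : set_type S := exist _ x (mem_set Sx).
  have Ns : N s by exact: MN.
  pose t : set_type N := exist _ s (mem_set Ns).
  have Wt : (f @^-1` W) t by rewrite hW.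
  exists (r^-1 *: (f t - c0)); last first.
    by rewrite scalerA mulfV ?gt_eqF// scale1r addrC subrK /G fK.
  move=> i; rewrite !mxE normrM gtr0_norm ?invr_gt0// -ltr_pdivlMl ?invr_gt0//.
  by rewrite invrK distrC; exact: Wt.
move=> [v hv <-]; set w := c0 + r *: v.
have cw i : `|c0 ord0 i - w ord0 i| < r * rho.
  rewrite !mxE opprD addrA subrr add0r normrN normrM gtr0_norm//.
  by rewrite ltr_pM2l.
split.
  have : (f @^-1` W) (g w) by rewrite /preimage /= gK.
  by rewrite hW.
apply: eM; apply/ball_rV => // i; apply: lt_trans (cw i) _.
have : r * rho <= r * 2 by rewrite ler_pM2l.
by rewrite /r in r0 *; lra.
Qed.

(** * Local certificates *)

Lemma cube_le_compact (R : realType) n (r a : R) (k : 'I_n) :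
  compact [set v : 'rV[R]_n | cube r v /\ v ord0 k <= a].
Proof.
have /continuous_closedP cl := @coord_continuous R 1 n ord0 k.
exact: compact_closedI (@cube_compact R n r) (cl _ (@closed_le R a)).
Qed.

Lemma cube_ge_compact (R : realType) n (r a : R) (k : 'I_n) :
  compact [set v : 'rV[R]_n | cube r v /\ a <= v ord0 k].
Proof.
have /continuous_closedP cl := @coord_continuous R 1 n ord0 k.
exact: compact_closedI (@cube_compact R n r) (cl _ (@closed_ge R a)).
Qed.

Lemma image_compact (T U : topologicalType) (f : T -> U) (A : set T) :
  continuous f -> compact A -> compact (f @` A).
Proof. by move=> cf; apply: continuous_compact; exact: continuous_subspaceT. Qed.

(* Around y take a chart h. The labels 2k and 2k+1 mark the sides v_k <= 1/2 and
   v_k >= -1/2 of the cube [-2,2]^n, the label 2n the part of S outside it. *)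
Lemma local_certificate (R : realType) (br : nat -> set nat)
    (X : topologicalType) (I : nat -> set X) (C D : set (nat * nat)) (S : set X)
    (n : nat) (y : X) :
  range br = [set A | finite_set A /\ A !=set0] ->
  basis (range I) ->
  (forall i j, D (i, j) -> I i `&` I j = set0) ->
  (forall i j, C (i, j) -> I i `<=` I j) ->
  (forall x y, x <> y -> exists i j, [/\ I i x, I j y & D (i, j)]) ->
  (forall i j x, I i x -> I j x -> exists k, [/\ I k x, C (k, i) & C (k, j)]) ->
  compact S -> manifold R n (set_type S) -> S y ->
  exists W conf G, [/\ open G, G y,
    forall i, certified br [set j | S `<=` Jset br I j] C D W conf i ->
      I i `&` S !=set0 &
    forall i x, G x -> S x -> I i x ->
      certified br [set j | S `<=` Jset br I j] C D W conf i].
Proof.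
move=> rbr bI Ddisj Csub Dsep Cmeet cS hM Sy.
have [h [ch hinj hS h0 hG]] := manifold_chart hM Sy.
have [G2 oG2 G2P] : exists2 G, open G & forall x, S x ->
    (G x <-> exists2 v : 'rV[R]_n, (forall i, `|v ord0 i| < 2) & h v = x).
  by apply: hG; rewrite ltr0n lexx.
have [G oG GP] : exists2 G, open G & forall x, S x ->
    (G x <-> exists2 v : 'rV[R]_n, (forall i, `|v ord0 i| < 1 / 2) & h v = x).
  by apply: hG; apply/andP; split; lra.
have avoid := cover_avoiding bI Ddisj Dsep.
(* Sets for the part of [S] outside the large cube, missing the small cube [-1,1]^n on which the
   covering theorem is used. *)
have [w0 [w01 w02]] : exists w : seq nat,
    (forall q x, q \in w -> (h @` cube 1) x -> ~ I q x) /\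
    forall x, (S `&` ~` G2) x -> exists2 q, q \in w & I q x.
  apply: avoid.
  - by apply: compact_closedI cS _; exact: open_closedC.
  - by apply: image_compact ch _; exact: cube_compact.
  move=> x [Sx nG2] [v cv hv]; apply: nG2; apply/G2P => //; exists v => // i.
  by apply: le_lt_trans (cv i) _; lra.
(* Sets around one side that miss the opposite face of the small cube; this provides the face
   condition of the covering theorem. *)
have /choice[wU hwU] : forall k : 'I_n, exists w : seq nat,
    (forall q x, q \in w ->
      (h @` [set v | cube 1 v /\ 1 <= v ord0 k]) x -> ~ I q x) /\
    forall x, (h @` [set v | cube 2 v /\ v ord0 k <= 1 / 2]) x ->
      exists2 q, q \in w & I q x.
  move=> k; apply: avoid.
  - by apply: image_compact ch _; exact: cube_le_compact.
  - by apply: image_compact ch _; exact: cube_ge_compact.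
  by move=> _ [v [_ v1] <-] [w [_ w1] /hinj wv]; rewrite wv in w1;
    clear -v1 w1; lra.
have /choice[wV hwV] : forall k : 'I_n, exists w : seq nat,
    (forall q x, q \in w ->
      (h @` [set v | cube 1 v /\ v ord0 k <= -1]) x -> ~ I q x) /\
    forall x, (h @` [set v | cube 2 v /\ - (1 / 2) <= v ord0 k]) x ->
      exists2 q, q \in w & I q x.
  move=> k; apply: avoid.
  - by apply: image_compact ch _; exact: cube_ge_compact.
  - by apply: image_compact ch _; exact: cube_le_compact.
  by move=> _ [v [_ v1] <-] [w [_ w1] /hinj wv]; rewrite wv in w1;
    clear -v1 w1; lra.
pose W := [seq (n.*2, q) | q <- w0] ++
  [seq ((nat_of_ord k).*2, q) | k <- enum 'I_n, q <- wU k] ++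
  [seq ((nat_of_ord k).*2.+1, q) | k <- enum 'I_n, q <- wV k].
pose conf := [seq ((nat_of_ord k).*2, (nat_of_ord k).*2.+1) | k <- enum 'I_n].
have confk (k : 'I_n) : ((nat_of_ord k).*2, (nat_of_ord k).*2.+1) \in conf.
  by apply/mapP; exists k; rewrite ?mem_enum.
exists W, conf, G; split => //.
- by apply/GP => //; exists 0 => // i; rewrite mxE normr0; lra.
(* Soundness: if [I i] missed [S], the members labelled by sides, pulled back along [h], would form
   a forbidden cover of [-1,1]^n. *)
- move=> i [j [lab [Sj h1 h2]]]; apply: contrapT => Ii0.
  pose U (k : 'I_n) := h @^-1` \bigcup_(p in [set p | [/\ br j p,
    lab p = (nat_of_ord k).*2 & exists2 q, q \in wU k & below C p q]]) I p.
  pose V (k : 'I_n) := h @^-1` \bigcup_(p in [set p | [/\ br j p,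
    lab p = (nat_of_ord k).*2.+1 & exists2 q, q \in wV k & below C p q]]) I p.
  have oh (E : set nat) : open (h @^-1` \bigcup_(p in E) I p).
    apply: open_comp; first by move=> ? _; exact: ch.
    by apply: bigcup_open => p _; exact: basis_open.
  apply: (@cube_not_covered R n U V) => [k|k|k v _|k v cv vk|k v cv vk|v cv];
    try exact: oh.
  + move=> [p [jp lp _] pv] [q [jq lq _] qv].
    by apply: (apart_disj Ddisj Csub (h2 p q jp jq _) pv qv); rewrite lp lq.
  + move=> [p [_ _ [q qw /(below_sub Csub) pq]] /pq qv].
    by apply: ((hwU k).1 q _ qw _ qv); exists v => //; split => //; rewrite vk.
  + move=> [p [_ _ [q qw /(below_sub Csub) pq]] /pq qv].
    by apply: ((hwV k).1 q _ qw _ qv); exists v => //; split => //; rewrite vk.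
  have [p jp pv] := Sj _ (hS v).
  have [pi|[c cW [lc pc]]] := h1 p jp.
    by case: Ii0; exists (h v); split; [rewrite -pi|exact: hS].
  move: cW; rewrite !mem_cat => /orP[/mapP[q qw ce]|/orP[]].
  + exfalso; apply: (w01 q (h v) qw); first by exists v.
    by move: pc; rewrite ce => /(below_sub Csub); exact.
  + move=> /allpairsPdep[k [q [_ qw ce]]]; exists k; left; exists p => //.
    by rewrite ce in lc pc; split => //; exists q.
  + move=> /allpairsPdep[k [q [_ qw ce]]]; exists k; right; exists p => //.
    by rewrite ce in lc pc; split => //; exists q.
(* Completeness: a certificate is built around [x = h c] with all coordinates of [c] below 1/2 in
   absolute value. *)
move=> i x Gx Sx Iix.
have [c cc hc] := (GP x Sx).1 Gx.
have /nbhs_ballP[e /= e0 eI] : nbhs c (h @^-1` I i).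
  by apply: ch; rewrite hc; apply: open_nbhs_nbhs; split => //; exact: basis_open.
have down (w : seq nat) p q : below C p q -> (exists2 r, r \in w & below C q r) ->
    exists2 r, r \in w & below C p r.
  by move=> pq [r rw qr]; exists r => //; exact: below_trans pq qr.
(* Since [c ord0 k - e < 1/2] and [c ord0 k + e > -1/2], both sides are covered by [wU k] and
   [wV k]; they are disjoint because [e > 0]. *)
have /choice[uU /choice[uV huv]] : forall k : 'I_n, exists u v : seq nat,
    [/\ forall p, p \in u -> exists2 q, q \in wU k & below C p q,
      forall p, p \in v -> exists2 q, q \in wV k & below C p q,
      forall x, (h @` [set v | cube 2 v /\ v ord0 k <= c ord0 k - e]) x ->
        exists2 p, p \in u & I p x,
      forall x, (h @` [set v | cube 2 v /\ c ord0 k + e <= v ord0 k]) x ->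
        exists2 q, q \in v & I q x &
      forall p q, p \in u -> q \in v -> apart C D p q].
  move=> k; have := cc k; rewrite ltr_norml => /andP[ck1 ck2].
  apply: (formal_separation bI Dsep Cmeet).
  - by apply: image_compact ch _; exact: cube_le_compact.
  - by apply: image_compact ch _; exact: cube_ge_compact.
  - by move=> _ [v [_ v1] <-] [w [_ w1] /hinj wv]; rewrite wv in w1;
    clear -v1 w1 e0; lra.
  - exact: down.
  - exact: down.
  - move=> _ [v [v2 vk] <-]; have [|q qw Iq] := (hwU k).2 (h v).
      by exists v => //; split => //; lra.
    by exists q => //; exists q => //; exact: below_refl.
  - move=> _ [v [v2 vk] <-]; have [|q qw Iq] := (hwV k).2 (h v).
      by exists v => //; split => //; lra.
    by exists q => //; exists q => //; exact: below_refl.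
pose L := i :: w0 ++ [seq p | k <- enum 'I_n, p <- uU k] ++
  [seq p | k <- enum 'I_n, p <- uV k].
(* An index may occur in several lists; any one label justified by an occurrence will do. *)
pose good p l := [\/ l = n.*2 /\ (p = i \/ p \in w0),
  exists2 k : 'I_n, l = (nat_of_ord k).*2 & p \in uU k |
  exists2 k : 'I_n, l = (nat_of_ord k).*2.+1 & p \in uV k].
have /choice[lab hlab] : forall p, exists l, p \in L -> good p l.
  move=> p; case: (boolP (p \in L)) => [|_]; last by exists 0%N.
  rewrite inE !mem_cat => /predU1P[->|/orP[pw|/orP[]]].
  - by exists n.*2 => _; apply: Or31; split => //; left.
  - by exists n.*2 => _; apply: Or31; split => //; right.
  - move=> /allpairsPdep[k [q [_ qw ->]]]; exists (nat_of_ord k).*2 => _.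
    by apply: Or32; exists k.
  - move=> /allpairsPdep[k [q [_ qw ->]]]; exists (nat_of_ord k).*2.+1 => _.
    by apply: Or33; exists k.
have [j _ jL] : range br [set` L].
  by rewrite rbr; split; [exact: finite_seq|exists i; rewrite /= mem_head].
exists j, lab; rewrite jL; split => /=.
- move=> z Sz; rewrite /Jset jL.
  have [G2z|nG2z] := pselect (G2 z); last first.
    have [//|q qw qz] := w02 z; exists q => //=.
    by rewrite inE !mem_cat qw orbT.
  have [v v2 hv] := (G2P z Sz).1 G2z.
  have c2 : cube 2 v by move=> k; exact: ltW.
  (* Either all coordinates are within [e] of [c], giving a point of [I i], or one of them puts the
     point on a side. *)
  have [vc|] := pselect (forall k, `|c ord0 k - v ord0 k| < e).
    exists i; first by rewrite /= mem_head.
    by rewrite -hv; apply: eI; apply/ball_rV.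
  move=> /existsNP[k /negP]; rewrite -leNgt ler_normr => ek.
  have [_ _ hU hV _] := huv k.
  have [vk|vk] : v ord0 k <= c ord0 k - e \/ c ord0 k + e <= v ord0 k.
    by case/orP: ek => ?; [left|right]; lra.
  + have [|p pu pz] := hU z; first by exists v.
    exists p => //=; rewrite inE !mem_cat; apply/orP; right; apply/orP; right.
    by apply/orP; left; apply/allpairsPdep; exists k, p; rewrite mem_enum.
  + have [|p pu pz] := hV z; first by exists v.
    exists p => //=; rewrite inE !mem_cat; apply/orP; right; apply/orP; right.
    by apply/orP; right; apply/allpairsPdep; exists k, p; rewrite mem_enum.
- move=> p /hlab[[lp [pi|pw]]|[k lp pu]|[k lp pu]]; first by left.
  + right; exists (n.*2, p); last by split => //; exact: below_refl.
    by rewrite !mem_cat map_f.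
  + have [/(_ p pu)[q qw pq] _ _ _ _] := huv k.
    right; exists ((nat_of_ord k).*2, q) => //; rewrite !mem_cat.
    apply/orP; right; apply/orP; left; apply/allpairsPdep.
    by exists k, q; rewrite mem_enum.
  + have [_ /(_ p pu)[q qw pq] _ _ _] := huv k.
    right; exists ((nat_of_ord k).*2.+1, q) => //; rewrite !mem_cat.
    apply/orP; right; apply/orP; right; apply/allpairsPdep.
    by exists k, q; rewrite mem_enum.
(* Parity and [k < n] determine from a conflicting pair of labels that [p] comes from [uU k] and [q]
   from [uV k]. *)
- move=> p q pL qL /mapP[k _ [lp lq]].
  have kn := ltn_ord k; have [_ _ _ _] := huv k; apply.
  + case: (hlab p pL); rewrite lp => -[].
    * by move=> ? _; lia.
    * by move=> k' e1; have -> : k = k' by apply/val_inj => /=; lia.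
    * by move=> k' ?; lia.
  + case: (hlab q qL); rewrite lq => -[].
    * by move=> ? _; lia.
    * by move=> k' ?; lia.
    * by move=> k' e1; have -> : k = k' by apply/val_inj => /=; lia.
Qed.

(** * Gluing finitely many local certificates *)

Theorem theorem6p4 (R : realType) (br : nat -> set nat)
    (hbr : finite_subsets_enum br)
    (X : topologicalType) (I : nat -> set X)
    (hX : computable_topological_space I)
    (S : set X) (hS : semicomputable br I S)
    (n : nat) (hn : (0 < n)%N) (hM : manifold R n (set_type S)) :
  computable_compact br I S.
Proof.
have [bI [C [D [hC [hD [Ddisj Csub Dsep Cmeet]]]]]] := hX.
have [cS ceS] := hS; have [rbr _ _] := hbr.
split => //; split.
  exact: compact_closed (formal_hausdorff bI Ddisj Dsep) cS.
(* Certificate data are chosen for every point of [X], with arbitrary values outside [S]. *)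
have /choice[W /choice[conf /choice[G hG]]] : forall y, exists W conf G, S y ->
    [/\ open G, G y,
      forall i, certified br [set j | S `<=` Jset br I j] C D W conf i ->
        I i `&` S !=set0 &
      forall i x, G x -> S x -> I i x ->
        certified br [set j | S `<=` Jset br I j] C D W conf i].
  move=> y; have [Sy|nSy] := pselect (S y); last by exists [::], [::], set0.
  have [W [conf [G h]]] :=
    local_certificate rbr bI Ddisj Csub Dsep Cmeet cS hM Sy.
  by exists W, conf, G.
have [y Sy|s [sS Scov]] := @compact_seq_cover _ _ S S G cS.
  by have [? ? _ _] := hG y Sy; exists y.
(* Completeness near the finitely many chosen points gives one inclusion, soundness the other. *)
rewrite (_ : [set i | _] = [set i | exists2 y, y \in s &
    certified br [set j | S `<=` Jset br I j] C D (W y) (conf y) i]).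
  by apply: ce_set1_bigcup_seq => y; exact: certified_ce.
apply/seteqP; split=> [i [x [ix Sx]]|i [y /sS Sy]].
  have [y ys Gx] := Scov x Sx; exists y => //.
  by have [_ _ _] := hG y (sS y ys); apply; [exact: Gx|exact: Sx|].
by have [_ _ + _] := hG y Sy; apply.
Qed.
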